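(* Let $A\in\mathbb{R}^{n_x\times n_x}$, $B\in\mathbb{R}^{n_x\times n_u}$, $E\in\mathbb{R}^{n_x\times n_w}$, $K\in\mathbb{R}^{n_u\times n_x}$, $\Sigma_w\succ 0$ in $\mathbb{R}^{n_w\times n_w}$ and $\varepsilon\in(0,1)$. Assume $\|A+BK\|<1$, $(A+BK,E)$ is reachable, and $B\neq 0$. Suppose $r>0$ satisfies $$r^2>\frac{1}{(1-\|A+BK\|)^2}\,\frac1\varepsilon\operatorname{Tr}(\Sigma_wE^\top E).$$ Consider the system $x_{t+1}=Ax_t+Bu_t+Ew_t$ with the event-triggered control $u_t=K\hat x_t$, where $\hat x_t=x_{t_k}$ for $t\in[t_k,t_{k+1})$, $t_0=0$, and the triggering times are $$t_{k+1}=\min\{t>t_k:\ \|K(x_{t_k}-x_t)\|>\sigma_4\}.$$ If $$\sigma_4\le\frac{1}{\|B\|}\left((1-\|A+BK\|)\,r-\sqrt{\frac1\varepsilon\operatorname{Tr}(\Sigma_wE^\top E)}\right),$$ then positive invariance with $\mathcal{D}=\{x\in\mathbb{R}^{n_x}:\|x\|^2-r^2\le0\}$ is guaranteed: for any state $x_t\in\mathcal{D}$, $\sup_{\mathbb{P}\in\mathcal{P}_k}\mathbb{P}\text{-CVaR}_\varepsilon[\|x_{t+k}\|^2-r^2]\le0$ for all $k\in\mathbb{Z}_{>0}$.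
   Context: $\|\cdot\|$ is the Euclidean norm on vectors and the maximum singular value on matrices; $M\succ 0$ means positive definite. Reachability of $(A+BK,E)$ means $\operatorname{rank}[E,(A+BK)E,\dots,(A+BK)^{n_x-1}E]=n_x$. CVaR: for a probability distribution $\mathbb{P}$ of a random vector $\xi$ and a measurable loss $L$, at level $\varepsilon\in(0,1)$, $\mathbb{P}\text{-CVaR}_\varepsilon[L(\xi)]=\inf_{\beta\in\mathbb{R}}\{\beta+\frac1\varepsilon\mathbb{E}_{\mathbb{P}}[(L(\xi)-\beta)^+]\}$, where $x^+=\max\{x,0\}$. The worst-case CVaR over a set of distributions is the supremum of CVaR over that set. Setting: the disturbances $w_t\in\mathbb{R}^{n_w}$, $t\in\mathbb{Z}_{\ge0}$, are i.i.d. with mean zero and covariance $\Sigma_w$, but their distribution is otherwise unknown. $\mathcal{P}_k$ is the set of all probability distributions on $\mathbb{R}^{n_wk}$ with mean zero and covariance $I_k\otimes\Sigma_w$. With $e_t=\hat x_t-x_t$ the closed loop reads $x_{t+1}=(A+BK)x_t+BKe_t+Ew_t$. If the set defining $t_{k+1}$ is empty, $t_{k+1}=\infty$; at a triggering time $\hat x_t$ is reset to $x_t$ (so $e_t=0$). In the positive invariance conclusion, the current state $x_t\in\mathcal{D}$ and the currently held state $\hat x_t$ (any value consistent with the trigger rule, i.e. $\hat x_t=x_t$ or $\|K(\hat x_t-x_t)\|\le\sigma_4$) are regarded as given deterministic vectors at time $t$; the closed loop is then run forward with the trigger rule, so $x_{t+k}$ is a function of these and of the stacked disturbance $[w_t^\top,\dots,w_{t+k-1}^\top]^\top$,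 whose law ranges over $\mathcal{P}_k$. *)

(* Defs.v *)
From HB Require Import structures.
From mathcomp Require Import all_boot all_order all_algebra.
From mathcomp Require Import mxtens.
From mathcomp Require Import all_classical all_reals all_analysis.

Set Implicit Arguments.
Unset Strict Implicit.
Unset Printing Implicit Defensive.

Import Order.TTheory GRing.Theory Num.Theory.
Import numFieldNormedType.Exports.

Local Open Scope classical_set_scope.
Local Open Scope ring_scope.

Section LinearAlgebra.
Context {R : realType}.

(* MathComp-Analysis' own norm `|x| on matrices is the sup norm. *)
Definition enorm n (x : 'cV[R]_n) : R := Num.sqrt (\sum_i x i 0 ^+ 2).

Definition singular_value m n (M : 'M[R]_(m, n)) : set R :=
  [set Num.sqrt l | l in [set l | eigenvalue (M^T *m M) l]].

(* The set is finite, so the supremum is a maximum (and 0 when n = 0). *)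
Definition specnorm m n (M : 'M[R]_(m, n)) : R := sup (singular_value M).

Definition posdef n (M : 'M[R]_n) : Prop :=
  M^T = M /\ forall v : 'cV[R]_n, v != 0 -> 0 < (v^T *m M *m v) 0 0.

Definition reachable n m (M : 'M[R]_n) (N : 'M[R]_(n, m)) : Prop :=
  \rank (\mxrow_(j < n) (M ^+ j *m N)) = n.

End LinearAlgebra.

Definition borelV (R : realType) (n : nat) :=
  g_sigma_algebraType (@open 'cV[R]_n).

Section WorstCaseCVaR.
Context {R : realType}.
Local Open Scope ereal_scope.

Definition CVaR d (T : measurableType d) (P : probability T R) (eps : R)
    (L : T -> R) : \bar R :=
  ereal_inf [set b%:E + (eps^-1)%:E * 'E_P[fun xi => Num.max (L xi - b)%R 0%R]
            | b in [set: R]].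

Definition worst_case_CVaR d (T : measurableType d)
    (Ps : set (probability T R)) (eps : R) (L : T -> R) : \bar R :=
  ereal_sup [set CVaR P eps L | P in Ps].

(* An undefined or infinite integral is never a real number in \bar R, so
   these equations force the coordinates to be square integrable. *)
Definition has_mean_cov n (P : probability (borelV R n) R)
    (mu : 'cV[R]_n) (S : 'M[R]_n) : Prop :=
  (forall i, 'E_P[fun W : borelV R n => (W : 'cV[R]_n) i 0%R] = (mu i 0%R)%:E)
  /\ (forall i j, covariance P (fun W : borelV R n => (W : 'cV[R]_n) i 0%R)
                               (fun W : borelV R n => (W : 'cV[R]_n) j 0%R)
                  = (S i j)%:E).

Definition ambiguity_set nw (Sw : 'M[R]_nw) (k : nat) :
    set (probability (borelV R (k * nw)) R) :=
  [set P | has_mean_cov P 0%R (tensmx (1%:M : 'M[R]_k) Sw)].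

End WorstCaseCVaR.

Arguments ambiguity_set {R nw} Sw k _.

Section EventTriggeredLoop.
Context {R : realType} {nx nu nw : nat}.
Variables (A : 'M[R]_nx) (B : 'M[R]_(nx, nu)) (E : 'M[R]_(nx, nw)).
Variables (K : 'M[R]_(nu, nx)) (sigma4 : R).

(* t' = min {t' > t : ||K (h - x_t')|| > sigma4}, with None for infinity *)
Definition next_trigger (x : nat -> 'cV[R]_nx) (h : 'cV[R]_nx) (t : nat)
    (t' : option nat) : Prop :=
  let fires s := sigma4 < enorm (K *m (h - x s)) in
  if t' is Some t' then
    [/\ (t < t')%N, fires t' & forall s, (t < s < t')%N -> ~~ fires s]
  else forall s, (t < s)%N -> ~~ fires s.

Definition before (s : nat) (t : option nat) : bool :=
  if t is Some t then (s < t)%N else true.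

(* Time is counted from the current instant: x s, xhat s and w s stand for
   x_{t+s}, xhat_{t+s} and w_{t+s}.  Accordingly the first holding interval
   starts at 0 with the given held state xhat0, which need not be x0 since the
   last trigger may lie in the past; each later one starts at a trigger time
   and holds the state reached there. *)
Definition closed_loop (x0 xhat0 : 'cV[R]_nx) (w : nat -> 'cV[R]_nw)
    (x : nat -> 'cV[R]_nx) : Prop :=
  exists (u : nat -> 'cV[R]_nu) (xhat : nat -> 'cV[R]_nx)
         (trig : nat -> option nat),
  [/\ x 0%N = x0,
      forall s, x s.+1 = A *m x s + B *m u s + E *m w s,
      forall s, u s = K *m xhat s,
      trig 0%N = Some 0%N &
      forall j, if trig j is Some t then
                  let h := if j == 0%N then xhat0 else x t in
                  next_trigger x h t (trig j.+1) /\
                  (forall s, (t <= s)%N -> before s (trig j.+1) -> xhat s = h)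
                else trig j.+1 = None].

(* Block s of a stacked disturbance in R^(k nw), and 0 from index k on (where
   it does not influence x_{t+k}); mxtens_index (i, j) is i * nw + j. *)
Definition unstack k (W : 'cV[R]_(k * nw)) (s : nat) : 'cV[R]_nw :=
  if insub s is Some i then \col_j W (mxtens_index (i : 'I_k, j)) 0 else 0.

Lemma closed_loop_exists x0 xhat0 w : exists x, closed_loop x0 xhat0 w x.
Proof.
pose step s (p : 'cV[R]_nx * 'cV[R]_nx) :=
  let y := A *m p.1 + B *m (K *m p.2) + E *m w s in
  (y, if sigma4 < enorm (K *m (p.2 - y)) then y else p.2).
pose st := fix st s := if s is s'.+1 then step s' (st s') else (x0, xhat0).
pose x s := (st s).1; pose xhat s := (st s).2.
have hatS s : xhat s.+1 =
    if sigma4 < enorm (K *m (xhat s - x s.+1)) then x s.+1 else xhat s by [].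
pose Q t s := (t < s)%N && (sigma4 < enorm (K *m (xhat t - x s))).
pose next t : option nat :=
  if pselect (exists s, Q t s) is left e then Some (ex_minn e) else None.
have nextP t : next_trigger x (xhat t) t (next t).
  rewrite /next; case: pselect => [e|e] /=.
    case: ex_minnP => m /andP[tm fm] mmin; split=> // s /andP[ts sm].
    apply/negP => fs; have := mmin s; rewrite /Q ts fs => /(_ isT).
    by rewrite leqNgt sm.
  by move=> s ts; apply/negP => fs; apply: e; exists s; rewrite /Q ts.
have hold t s : (t <= s)%N -> before s (next t) -> xhat s = xhat t.
  have nf i : (t < i)%N -> before i (next t) ->
      ~~ (sigma4 < enorm (K *m (xhat t - x i))).
    move=> ti; move: (nextP t); case: (next t) => [m [_ _ h] im|h _] /=.
      by apply: h; rewrite ti.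
    exact: h.
  have bW i : before i.+1 (next t) -> before i (next t).
    by case: (next t) => //= m; apply: ltnW.
  elim: s => [|s IH]; first by rewrite leqn0 => /eqP ->.
  rewrite leq_eqVlt => /predU1P[-> //|ts] b.
  by rewrite hatS (IH ts (bW _ b)) (negbTE (nf _ ts b)).
pose trig := fix trig j := if j is j'.+1 then obind next (trig j') else Some 0%N.
have resets t t' : next t = Some t' -> xhat t' = x t'.
  move=> e; have := nextP t; rewrite e => -[]; case: t' e => // t' e tt' f _.
  by rewrite hatS (@hold t t') ?f // e /=.
have held j t : trig j = Some t -> (if j == 0%N then xhat0 else x t) = xhat t.
  case: j => [[<-]//|j] /=; case: (trig j) => //= t0; exact/fsym/resets.
exists x, (fun s => K *m xhat s), xhat, trig; split=> // j.
case e: (trig j) => [t|] /=; last by rewrite e.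
rewrite (held _ _ e) e /=; split; [exact: nextP | exact: hold].
Qed.

End EventTriggeredLoop.

(* Main.v *)
(* Let M = A + BK, c = |M|, T = Tr(Sw E^T E), s = sqrt(T / eps) and
   d = (1 - c) r - s, so that r = c r + d + s and d >= 0.  The trigger rule keeps
   |B K e_t| <= d.  Jensen's inequality for the squared norm with weights c r, d
   and s then gives, along every path,
     |x_{t+1}|^2 <= c |x_t|^2 + r d + (r / s) |E w_t|^2.
   Iterating, |x_{t+k}|^2 is at most a constant b_k plus a nonnegative quadratic
   noise term g_k, where E|E w_t|^2 = T is the only property of the law that
   matters; since r (c r + d + s) = r^2, induction gives b_k + E[g_k] / eps = r^2,
   and beta = b_k - r^2 shows CVaR <= 0. *)
Require Import Defs.
From mathcomp Require Import all_boot all_order all_algebra.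
From mathcomp Require Import ring lra.
From mathcomp Require Import mxtens.
From mathcomp Require Import all_classical all_reals all_analysis.
From mathcomp Require Import measurable_realfun.

Set Implicit Arguments.
Unset Strict Implicit.
Unset Printing Implicit Defensive.

Import Order.TTheory GRing.Theory Num.Theory.
Import numFieldNormedType.Exports.
Local Open Scope classical_set_scope.
Local Open Scope ring_scope.

(** * The Euclidean norm, and the spectral norm as the operator norm it induces *)

Section EuclideanNorm.
Context {R : realType}.

Lemma enorm_ge0 n (x : 'cV[R]_n) : 0 <= enorm x.
Proof. exact: sqrtr_ge0. Qed.

Lemma enorm_sqr n (x : 'cV[R]_n) : enorm x ^+ 2 = \sum_i x i 0 ^+ 2.
Proof. by rewrite sqr_sqrtr// sumr_ge0// => i _; exact: sqr_ge0. Qed.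

Lemma enorm_sqr_mx n (x : 'cV[R]_n) : enorm x ^+ 2 = (x^T *m x) 0 0.
Proof. by rewrite enorm_sqr mxE; apply: eq_bigr => i _; rewrite mxE expr2. Qed.

Lemma enorm0 n : enorm (0 : 'cV[R]_n) = 0.
Proof.
by rewrite /enorm big1 ?sqrtr0// => i _; rewrite mxE expr0n.
Qed.

Lemma enorm_eq0 n (x : 'cV[R]_n) : enorm x = 0 -> x = 0.
Proof.
move=> x0; have := enorm_sqr x; rewrite x0 expr0n => /esym/eqP.
rewrite psumr_eq0 => [/allP h|i _]; last exact: sqr_ge0.
apply/matrixP => i j; rewrite mxE ord1; apply/eqP.
by have := h i (mem_index_enum _); rewrite sqrf_eq0.
Qed.

(* Jensen's inequality for the squared norm with weights p and q, in the form
   that also covers vanishing weights. *)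
Lemma enorm_sqrD_le n (u v : 'cV[R]_n) (p q a b : R) :
  0 <= p -> 0 <= q -> 0 <= a -> 0 <= b ->
  enorm u ^+ 2 <= p * a -> enorm v ^+ 2 <= q * b ->
  enorm (u + v) ^+ 2 <= (p + q) * (a + b).
Proof.
move=> p0 q0 a0 b0 up vq.
have nul m (w : 'cV[R]_m) c : enorm w ^+ 2 <= 0 * c -> w = 0.
  by rewrite mul0r real_exprn_even_le0//= => /eqP /enorm_eq0.
move: p0; rewrite le_eqVlt => /predU1P[p0|p0].
  subst p; rewrite (nul _ _ _ up) !add0r (le_trans vq)// ler_wpM2l//.
  by rewrite lerDr.
move: q0; rewrite le_eqVlt => /predU1P[q0|q0].
  subst q; rewrite (nul _ _ _ vq) !addr0 (le_trans up)// ler_wpM2l//; last lra.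
  exact: ltW.
have cross : 0 <= enorm (q *: u - p *: v) ^+ 2 by exact: sqr_ge0.
rewrite -(ler_pM2r (mulr_gt0 p0 q0)).
(* Multiplied by [p * q], the gap in Jensen's inequality is exactly the square [|q u - p v|^2]. *)
have crossE : enorm (u + v) ^+ 2 * (p * q) + enorm (q *: u - p *: v) ^+ 2
    = (p + q) * (q * enorm u ^+ 2 + p * enorm v ^+ 2).
  rewrite !enorm_sqr mulr_suml !mulr_sumr -!big_split/= mulr_sumr.
  by apply: eq_bigr => i _; rewrite !mxE; ring.
have : (p + q) * (q * enorm u ^+ 2 + p * enorm v ^+ 2) <=
       (p + q) * (q * (p * a) + p * (q * b)).
  rewrite ler_wpM2l ?addr_ge0 ?(ltW p0) ?(ltW q0)// lerD//.
    by rewrite ler_wpM2l// ltW.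
  by rewrite ler_wpM2l// ltW.
set t := enorm (u + v) ^+ 2 * _ in crossE *; move: cross crossE.
set z := enorm _ ^+ 2; set y := (p + q) * (q * enorm _ ^+ 2 + _) => z0 e yle.
have -> : (p + q) * (a + b) * (p * q) = (p + q) * (q * (p * a) + p * (q * b)).
  by ring.
lra.
Qed.

Lemma continuous_quadratic n (N : 'M[R]_n) :
  continuous (fun v : 'rV[R]_n => (v *m N *m v^T) 0 0).
Proof.
have -> : (fun v : 'rV[R]_n => (v *m N *m v^T) 0 0) =
    (fun v => \sum_j (\sum_i v 0 i * N i j) * v 0 j).
  by apply/funext => v; rewrite mxE; apply: eq_bigr => j _; rewrite !mxE.
apply: continuous_big => [|j _]; first exact: add_continuous.
move=> v; apply: continuousM; last exact: coord_continuous.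
apply: (continuous_big (op := +%R)) => [|i _]; first exact: add_continuous.
move=> w; apply: continuousM; first exact: coord_continuous.
exact: cst_continuous.
Qed.

Let sq n (v : 'rV[R]_n) := (v *m v^T) 0 0.

Let sqE n (v : 'rV[R]_n) : sq v = \sum_i v 0 i ^+ 2.
Proof. by rewrite /sq mxE; apply: eq_bigr => i _; rewrite mxE expr2. Qed.

Let sq_ge0 n (v : 'rV[R]_n) : 0 <= sq v.
Proof. by rewrite sqE sumr_ge0// => i _; exact: sqr_ge0. Qed.

Let sq_eq0 n (v : 'rV[R]_n) : sq v = 0 -> v = 0.
Proof.
rewrite sqE => /eqP; rewrite psumr_eq0 => [/allP h|i _]; last exact: sqr_ge0.
apply/rowP => i; rewrite mxE; apply/eqP.
by have := h i (mem_index_enum _); rewrite sqrf_eq0.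
Qed.

Lemma compact_sphere n : compact [set v : 'rV[R]_n | (v *m v^T) 0 0 = 1].
Proof.
apply: bounded_closed_compact.
  exists 1; split; first exact: num_real.
  (* The ambient norm is the sup norm, so it suffices to bound each entry: its square is one term of
     a sum equal to 1. *)
  move=> M M1 v /= v1; rewrite (le_trans _ (ltW M1))//.
  rewrite /Num.norm/= mx_normrE; apply: bigmax_le => // -[i j] _ /=.
  rewrite ord1.
  rewrite -(ler_pXn2r (n := 2)) ?nnegrE// expr1n real_normK ?num_real//.
  rewrite -v1 -/(sq v) sqE (bigD1 j)//= lerDl sumr_ge0// => k _.
  exact: sqr_ge0.
have -> : [set v : 'rV[R]_n | (v *m v^T) 0 0 = 1] =
    (fun v : 'rV[R]_n => (v *m 1%:M *m v^T) 0 0) @^-1` [set 1].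
  by apply/funext => v; rewrite /= mulmx1.
apply: preimage_closed; last exact: closed_eq.
by move=> v _; exact: continuous_quadratic.
Qed.

Lemma quadratic_formD n (Q : 'M[R]_n) (a b : 'rV[R]_n) (t : R) :
  ((a + t *: b) *m Q *m (a + t *: b)^T) 0 0 =
  (a *m Q *m a^T) 0 0 + t * ((a *m Q *m b^T) 0 0 + (b *m Q *m a^T) 0 0)
  + t ^+ 2 * (b *m Q *m b^T) 0 0.
Proof.
have entryD (x y : 'M[R]_1) : (x + y) 0 0 = x 0 0 + y 0 0 by rewrite mxE.
have entryZ s (x : 'M[R]_1) : (s *: x) 0 0 = s * x 0 0 by rewrite mxE.
rewrite [_^T]linearD/= [(t *: b)^T]linearZ/= !mulmxDl !mulmxDr.
by rewrite -!scalemxAl -!scalemxAr !entryD !entryZ; ring.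
Qed.

(** A maximizer [c] of the quadratic form on the compact unit sphere, with value [mu], makes
    [Q = mu I - N] positive semidefinite with [c Q c^T = 0]. A null vector of a semidefinite form
    lies in its kernel, so [c] is an eigenvector. Row vectors are used because [eigenvalue] refers
    to left eigenvectors. *)
Lemma rayleigh_max n (N : 'M[R]_n.+1) : N^T = N ->
  exists mu (c : 'rV[R]_n.+1), [/\ c != 0, c *m N = mu *: c &
    forall w : 'rV[R]_n.+1, (w *m N *m w^T) 0 0 <= mu * (w *m w^T) 0 0].
Proof.
move=> Nsym; pose q (v : 'rV[R]_n.+1) := (v *m N *m v^T) 0 0.
have A0 : [set v : 'rV[R]_n.+1 | (v *m v^T) 0 0 = 1] !=set0.
  exists (delta_mx 0 0); rewrite /= trmx_delta mul_delta_mx mxE eqxx.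
  by rewrite mulr1n.
have [c + cmax] := EVT_max_rV A0 (@compact_sphere _)
  (continuous_subspaceT (@continuous_quadratic _ N)).
rewrite inE /= => c1; pose mu := q c.
have qle w : q w <= mu * sq w.
  have [->|w0] := eqVneq w 0.
    by rewrite /q /sq !mul0mx !mxE mulr0.
  have sw : 0 < sq w.
    by rewrite lt_neqAle sq_ge0 andbT eq_sym; apply: contra_neq w0; exact: sq_eq0.
  pose t := (Num.sqrt (sq w))^-1.
  have t2 : t ^+ 2 * sq w = 1.
    by rewrite exprVn sqr_sqrtr ?(ltW sw)// mulVf// gt_eqF.
  have /cmax : t *: w \in [set v : 'rV[R]_n.+1 | (v *m v^T) 0 0 = 1].
    by rewrite inE /= linearZ/= -scalemxAl -scalemxAr scalerA mxE -expr2 -t2.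
  rewrite linearZ/= -!scalemxAl -scalemxAr scalerA mxE -expr2 -/(q w) -/(q c).
  rewrite -/mu => h; rewrite -(ler_pM2l (_ : 0 < t ^+ 2)).
    by rewrite mulrCA t2 mulr1.
  by rewrite exprn_gt0// invr_gt0 sqrtr_gt0.
pose Q := mu%:M - N; pose u := c *m Q.
have qQ w : (w *m Q *m w^T) 0 0 = mu * sq w - q w.
  rewrite /Q mulmxBr mulmxBl mul_mx_scalar -scalemxAl.
  by rewrite mxE [X in X + _]mxE [X in _ + X]mxE.
have Qsym : Q^T = Q by rewrite /Q linearB/= tr_scalar_mx Nsym.
have cQc : (c *m Q *m c^T) 0 0 = 0 by rewrite qQ /sq c1 mulr1 subrr.
(* This is the form of [Q] at [c + t u]: the constant term vanishes, and both cross terms equal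
   [|u|^2] since [u = c Q]. *)
have psd t : 0 <= t *+ 2 * sq u + t ^+ 2 * (u *m Q *m u^T) 0 0.
  have psdw (w : 'rV[R]_n.+1) : 0 <= (w *m Q *m w^T) 0 0 by rewrite qQ subr_ge0.
  have e : (u *m Q *m c^T) 0 0 = sq u.
    have -> : u *m Q *m c^T = (u *m u^T)^T.
      by rewrite /u !trmx_mul !trmxK Qsym !mulmxA.
    by rewrite mxE.
  rewrite (le_trans (psdw (c + t *: u)))// quadratic_formD cQc e -/u -/(sq u).
  by rewrite le_eqVlt; apply/orP; left; apply/eqP; ring.
exists mu, c; split=> //.
  apply/eqP => c0; move: c1; rewrite c0 mul0mx mxE => /eqP.
  by rewrite eq_sym oner_eq0.
suff /sq_eq0 : sq u = 0.
  by rewrite /u /Q mulmxBr mul_mx_scalar => /eqP; rewrite subr_eq0 => /eqP.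
have b0 : 0 <= (u *m Q *m u^T) 0 0 by rewrite qQ subr_ge0.
have := sq_ge0 u; move: psd b0; move: (sq u) (_ 0 0) => a b psd b0 a0.
apply/eqP; apply/negPn/negP => an.
have {a0 an}a0 : 0 < a by rewrite lt_neqAle eq_sym an.
have b1 : 0 < b + 1 by lra.
(* A small negative [t] lets the linear term win; the denominator [b + 1] stays positive even for
   [b = 0]. *)
have := psd (- a / (b + 1)).
have -> : (- a / (b + 1)) *+ 2 * a + (- a / (b + 1)) ^+ 2 * b =
   - (a ^+ 2 * (b + 2) / (b + 1) ^+ 2).
  by field; rewrite gt_eqF.
rewrite oppr_ge0 leNgt divr_gt0// ?exprn_gt0// mulr_gt0// ?exprn_gt0//.
by lra.
Qed.

(** The Rayleigh maximum [mu] of [M^T M] is an eigenvalue that bounds all others and satisfies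
    [|M v|^2 <= mu |v|^2]. Both claims follow from [sqrt mu <= specnorm M]. *)
Lemma enorm_specnorm m n (M : 'M[R]_(m, n)) (v : 'cV[R]_n) :
  0 <= specnorm M /\ enorm (M *m v) <= specnorm M * enorm v.
Proof.
(* Without columns there are no eigenvectors, and the supremum of the empty set is 0 by
   convention. *)
case: n M v => [|n] M v.
  have -> : specnorm M = 0.
    rewrite /specnorm /singular_value (_ : [set _ | _ in _] = set0) ?sup0//.
    apply/seteqP; split=> // l [l' /= /eigenvalueP[w _ /eqP[]]].
    by apply/rowP => -[].
  have -> : v = 0 by apply/colP => -[].
  by rewrite mulmx0 !enorm0 mulr0.
have Nsym : (M^T *m M)^T = M^T *m M by rewrite trmx_mul trmxK.
have [mu [c [c0 cN qle]]] := rayleigh_max Nsym.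
(* [sup] dominates the members of a set only if the set is bounded above. *)
have ub : has_ubound (singular_value M).
  exists (Num.sqrt mu) => _ [l /= /eigenvalueP[w wN w0] <-].
  rewrite ler_wsqrtr//.
  have := qle w; rewrite wN -scalemxAl mxE -/(sq w) ler_pM2r//.
  by rewrite lt_neqAle sq_ge0 andbT eq_sym; apply: contra_neq w0; exact: sq_eq0.
have mu_le : Num.sqrt mu <= specnorm M.
  by apply: ub_le_sup => //; exists mu => //=; apply/eigenvalueP; exists c.
have s0 : 0 <= specnorm M by exact: le_trans (sqrtr_ge0 _) mu_le.
have sqM (w : 'cV[R]_n.+1) : enorm (M *m w) ^+ 2 <= mu * enorm w ^+ 2.
  by rewrite !enorm_sqr_mx trmx_mul -!mulmxA mulmxA; have := qle w^T; rewrite trmxK -!mulmxA.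
have mu0 : 0 <= mu.
  have := le_trans (sqr_ge0 _) (sqM c^T).
  rewrite enorm_sqr_mx trmxK -/(sq c) pmulr_lge0//.
  by rewrite lt_neqAle sq_ge0 andbT eq_sym; apply: contra_neq c0; exact: sq_eq0.
split=> //; rewrite -(ler_pXn2r (n := 2)) ?nnegrE ?mulr_ge0 ?enorm_ge0//.
rewrite (le_trans (sqM v))// exprMn ler_wpM2r ?sqr_ge0//.
by rewrite -(sqr_sqrtr mu0) ler_pXn2r// nnegrE// sqrtr_ge0.
Qed.

Lemma specnorm_ge0 m n (M : 'M[R]_(m, n)) : 0 <= specnorm M.
Proof. exact: (enorm_specnorm M 0).1. Qed.

Lemma enorm_mulmx_le m n (M : 'M[R]_(m, n)) v :
  enorm (M *m v) <= specnorm M * enorm v.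
Proof. exact: (enorm_specnorm M v).2. Qed.

Lemma specnorm_gt0 m n (M : 'M[R]_(m, n)) : M != 0 -> 0 < specnorm M.
Proof.
move=> M0; rewrite lt_neqAle specnorm_ge0 andbT eq_sym.
apply: contra_neq M0 => s0; apply/matrixP => i j.
have /enorm_eq0 : enorm (M *m (delta_mx j 0 : 'cV[R]_n)) = 0.
  by apply/eqP; rewrite eq_le enorm_ge0 (le_trans (enorm_mulmx_le _ _))// s0 mul0r.
by rewrite -colE => /colP/(_ i); rewrite !mxE.
Qed.

End EuclideanNorm.

(** * One step of the closed loop under the trigger rule *)

Section ClosedLoop.
Context {R : realType} {nx nu nw : nat}.
Variables (A : 'M[R]_nx) (B : 'M[R]_(nx, nu)) (E : 'M[R]_(nx, nw)).
Variables (K : 'M[R]_(nu, nx)) (sigma4 : R).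

(* For a negative threshold the rule triggers at every step, and the error
   vanishes; hence the maximum with 0. *)
Lemma closed_loop_step x0 xhat0 w x :
  closed_loop A B E K sigma4 x0 xhat0 w x ->
  xhat0 = x0 \/ enorm (K *m (xhat0 - x0)) <= sigma4 ->
  forall s, exists2 e : 'cV[R]_nu, enorm e <= Num.max sigma4 0 &
    x s.+1 = (A + B *m K) *m x s + B *m e + E *m w s.
Proof.
move=> [u [xhat [trig [x00 xS uE trig0 trigP]]]] hhat s.
have next_before j t : trig j = Some t -> before t (trig j.+1).
  by move=> tj; have := trigP j; rewrite tj => -[]; case: (trig _) => //= ? [].
(* Locate the holding interval that contains [s]; in the induction, [s + 1] either stays in the
   interval or is the next trigger time. *)
have [j [t [tj ts sj]]] :
    exists j t, [/\ trig j = Some t, (t <= s)%N & before s (trig j.+1)].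
  elim: s => [|s [j [t [tj ts sj]]]].
    by exists 0%N, 0%N; split=> //; exact: next_before.
  case tj1: (trig j.+1) sj => [t'|] /= sj.
    have [st'|t's] := ltnP s.+1 t'.
      by exists j, t; split; rewrite ?tj1// ltnW.
    exists j.+1, t'; split=> //; have /eqP <- : t' == s.+1 by rewrite eqn_leq t's.
    exact: next_before.
  by exists j, t; split; rewrite ?tj1// ltnW.
exists (K *m (xhat s - x s)); last first.
  by rewrite xS uE mulmxBr mulmxBr mulmxDl !mulmxA addrACA subrr addr0.
rewrite le_max; have := trigP j; rewrite tj /= => -[hnext -> //].
(* After the start of the interval the rule has not fired, which bounds the error by [sigma4]. At
   the start the error is zero, except at time 0, where the assumption on [xhat0] applies. *)
have [st|st] := eqVneq s t; last first.
  apply/orP; left; rewrite leNgt.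
  have {}ts : (t < s)%N by rewrite ltn_neqAle eq_sym st.
  move: hnext sj; case: (trig j.+1) => [t' [_ _ quiet] /= st'|quiet _].
    by apply: quiet; rewrite ts.
  exact: quiet.
subst t; case: j tj {sj hnext} => [|j] tj /=.
  move: tj; rewrite trig0 => -[<-]; rewrite x00; case: hhat => [->|->//].
  by rewrite subrr mulmx0 enorm0 lexx orbT.
by rewrite subrr mulmx0 enorm0 lexx orbT.
Qed.

End ClosedLoop.

(** * Expectations, a bound on CVaR, and second moments of the disturbance *)

Section Expectation.
Context {R : realType}.

(** Integrability is carried along with the value so that linearity of the integral propagates
    through sums. *)
Definition has_mean d (T : measurableType d) (P : probability T R)
    (f : T -> R) (m : R) : Prop :=
  P.-integrable setT (EFin \o f) /\ (\int[P]_w (f w)%:E)%E = m%:E.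

Section HasMean.
Context d (T : measurableType d) (P : probability T R).

Lemma has_meanZ (a : R) f m :
  has_mean P f m -> has_mean P (fun w => a * f w) (a * m).
Proof.
move=> [fi fm]; split.
  rewrite [X in P.-integrable _ X](_ : _ = fun w => (a%:E * (f w)%:E)%E)//.
  exact: integrableZl.
under eq_integral do rewrite EFinM.
by rewrite integralZl// fm.
Qed.

Lemma has_meanD f g m p :
  has_mean P f m -> has_mean P g p -> has_mean P (fun w => f w + g w) (m + p).
Proof.
move=> [fi fm] [gi gp]; split.
  rewrite [X in P.-integrable _ X](_ : _ = ((EFin \o f) \+ (EFin \o g))%E)//.
  exact: integrableD.
under eq_integral do rewrite EFinD.
by rewrite integralD// fm gp.
Qed.

Lemma has_mean0 : has_mean P (fun=> 0) 0.
Proof. by split; [exact: integrable0|exact: integral0]. Qed.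

Lemma has_mean_sum I (s : seq I) (f : I -> T -> R) (m : I -> R) :
  (forall i, has_mean P (f i) (m i)) ->
  has_mean P (fun w => \sum_(i <- s) f i w) (\sum_(i <- s) m i).
Proof.
move=> fm; elim: s => [|i s IH].
  by under eq_fun do rewrite big_nil; rewrite big_nil; exact: has_mean0.
under eq_fun do rewrite big_cons; rewrite big_cons.
exact: has_meanD.
Qed.

(* Applied to the loss of the closed loop, whose measurability is never needed:
   the integral of a nonnegative function is a supremum over simple functions. *)
Lemma ge0_le_integral_nonmeasurable (f g : T -> \bar R) :
  (forall w, 0 <= f w)%E -> (forall w, f w <= g w)%E ->
  (\int[P]_w f w <= \int[P]_w g w)%E.
Proof.
move=> f0 fg; have g0 w : (0 <= g w)%E by exact: le_trans (f0 w) (fg w).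
rewrite !ge0_integralTE//; apply: le_ereal_sup => _ [h /= hf <-].
by exists h => //= w; exact: le_trans (hf w) (fg w).
Qed.

(** Take [beta = b] in the infimum: since [g] is nonnegative and dominates [L - b], it dominates the
    positive part. *)
Lemma CVaR_le (eps b m : R) (L g : T -> R) :
  0 <= eps -> (forall w, 0 <= g w) -> (forall w, L w <= b + g w) ->
  has_mean P g m -> (CVaR P eps L <= (b + eps^-1 * m)%:E)%E.
Proof.
move=> eps0 g0 Lg [_ gm].
apply: (le_trans (ereal_inf_lbound _)); first by exists b.
rewrite EFinD leeD2l// EFinM lee_wpmul2l ?lee_fin ?invr_ge0// -gm.
rewrite unlock; apply: ge0_le_integral_nonmeasurable => w.
  by rewrite lee_fin le_max lexx orbT.
by rewrite lee_fin ge_max g0 lerBlDl Lg.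
Qed.

End HasMean.

Lemma measurable_coord n (i : 'I_n) :
  measurable_fun setT (fun W : borelV R n => (W : 'cV[R]_n) i 0).
Proof.
apply: (measurability _ (RGenOpens.measurableE R)).
move=> _ [_ [a [b ->] <-]]; rewrite setTI; apply: sub_sigma_algebra.
have /continuousP := @coord_continuous R n 1 i 0; apply.
exact: interval_open.
Qed.

Lemma has_mean_coordM n (P : probability (borelV R n) R) (S : 'M[R]_n) i j :
  has_mean_cov P 0 S ->
  has_mean P (fun W : borelV R n => (W : 'cV[R]_n) i 0 * (W : 'cV[R]_n) j 0)
    (S i j).
Proof.
move=> [mean cov].
pose X i := fun W : borelV R n => (W : 'cV[R]_n) i 0.
have covE k l : (\int[P]_W (X k W * X l W)%:E)%E = (S k l)%:E.
  rewrite -cov unlock; transitivity ('E_P[fun W => (X k W * X l W)%R])%E.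
    by rewrite unlock.
  rewrite !mean !mxE/=; congr expectation; apply/funext => W /=.
  by rewrite -[RHS]/((_ - 0) * (_ - 0)) !subr0.
have mX k : measurable_fun setT (X k) by exact: measurable_coord.
(* The square is its own absolute value, and its integral is the real number [S k k]. *)
have sq_int k : P.-integrable setT (EFin \o (fun W => X k W * X k W)).
  apply/integrableP; split; first exact/measurable_EFinP/measurable_funM.
  under eq_integral do rewrite /= ger0_norm -?expr2 ?sqr_ge0// expr2.
  by rewrite covE ltry.
split; last exact: covE.
(* Domination by [|a b| <= a^2 + b^2]. *)
apply: (le_integrable measurableT _ _ (integrableD measurableT (sq_int i) (sq_int j))).
  by apply/measurable_EFinP; exact: (measurable_funM (mX i) (mX j)).
move=> W _ /=; rewrite lee_fin [leRHS]ger0_norm -?expr2 ?addr_ge0 ?sqr_ge0//.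
rewrite -/(X i W) -/(X j W).
rewrite ler_norml; move: (X i W) (X j W) => a b; apply/andP; split; nra.
Qed.

Lemma trace_cov m n (E : 'M[R]_(m, n)) (S : 'M[R]_n) :
  \tr (S *m E^T *m E) = \sum_i \sum_l \sum_p E i l * E i p * S l p.
Proof.
rewrite mxtrace_mulC mulmxA; apply: eq_bigr => i _.
rewrite mxE exchange_big/=; apply: eq_bigr => p _.
by rewrite !mxE mulr_suml; apply: eq_bigr => l _; rewrite mulrAC.
Qed.

(** [|E w_s|^2] is a quadratic polynomial in the coordinates of block [s], so only the diagonal
    block [Sw] of the Kronecker product enters. *)
Lemma has_mean_block nx nw k (E : 'M[R]_(nx, nw)) (Sw : 'M[R]_nw)
    (P : probability (borelV R (k * nw)) R) s :
  (s < k)%N -> ambiguity_set Sw k P ->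
  has_mean P (fun W => enorm (E *m unstack (W : 'cV[R]_(k * nw)) s) ^+ 2)
    (\tr (Sw *m E^T *m E)).
Proof.
move=> sk cov; rewrite trace_cov; pose s' := Ordinal sk.
pose a l : 'I_(k * nw) := mxtens_index (s', l).
have -> : (fun W : borelV R (k * nw) =>
      enorm (E *m unstack (W : 'cV[R]_(k * nw)) s) ^+ 2) =
    fun W => \sum_i \sum_l \sum_p
      E i l * E i p * ((W : 'cV[R]_(k * nw)) (a l) 0 * (W : 'cV[R]_(k * nw)) (a p) 0).
  apply/funext => W; rewrite enorm_sqr; apply: eq_bigr => i _.
  rewrite mxE expr2 mulr_suml; apply: eq_bigr => l _.
  rewrite mulr_sumr; apply: eq_bigr => p _.
  rewrite /unstack insubT/= !mxE mulrACA -/s'.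
  by congr (_ * (W _ _ * W _ _)); apply/val_inj.
apply: has_mean_sum => i; apply: has_mean_sum => l; apply: has_mean_sum => p.
apply: has_meanZ.
have -> : Sw l p = tensmx (1%:M : 'M[R]_k) Sw (a l) (a p).
  by rewrite tensmxE mxE eqxx mul1r.
exact: has_mean_coordM.
Qed.

End Expectation.

(** The trace is the sum of the values of the form [S] at the rows of [E]. It settles the degenerate
    case: zero noise power forces [E = 0]. *)
Lemma posdef_trace_eq0 (R : realType) m n (E : 'M[R]_(m, n)) (S : 'M[R]_n) :
  posdef S -> 0 <= \tr (S *m E^T *m E) /\ (\tr (S *m E^T *m E) = 0 -> E = 0).
Proof.
move=> [_ Spos].
have trE : \tr (S *m E^T *m E) = \sum_i (row i E *m S *m (row i E)^T) 0 0.
  rewrite mxtrace_mulC mulmxA; apply: eq_bigr => i _.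
  by rewrite -row_mul mxE [RHS]mxE; apply: eq_bigr => j _; rewrite !mxE.
have row_ge0 i : 0 <= (row i E *m S *m (row i E)^T) 0 0.
  have [->|r0] := eqVneq (row i E) 0; first by rewrite !mul0mx mxE.
  by rewrite ltW// -{1}(trmxK (row i E)) Spos// trmx_eq0.
split; first by rewrite trE sumr_ge0.
rewrite trE => /eqP; rewrite psumr_eq0// => /allP h; apply/row_matrixP => i.
rewrite row0; apply/eqP/negPn/negP => r0.
have := Spos (row i E)^T; rewrite trmx_eq0 trmxK => /(_ r0).
by rewrite (eqP (h i (mem_index_enum _))) ltxx.
Qed.

(** * The recursive bound on the squared norm of the state *)

Section SquaredNormBound.
Context {R : realType}.
Variables (c d r s : R).

(** The constants [b_n], started at [r ^+ 2] because the initial state lies in the ball. *)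
Fixpoint drift (n : nat) : R :=
  if n is n'.+1 then c * drift n' + r * d else r ^+ 2.

(** The terms [g_n], for an arbitrary sequence [y]: it serves pathwise with [|E w_i|^2] and in the
    mean with a constant. *)
Fixpoint noise (y : nat -> R) (n : nat) : R :=
  if n is n'.+1 then c * noise y n' + r / s * y n' else 0.

Lemma noise_ge0 y n :
  0 <= c -> 0 <= r -> 0 <= s -> (forall i, 0 <= y i) -> 0 <= noise y n.
Proof.
move=> c0 r0 s0 y0; elim: n => //= n IH.
by rewrite addr_ge0 ?mulr_ge0 ?invr_ge0.
Qed.

(** The sum obeys [z -> c z + r d + r s], which fixes [r ^+ 2]. The condition on [t] is met by
    [t = s ^+ 2]. *)
Lemma drift_noise_sum t n : r = c * r + d + s -> 0 <= c ->
  r / s * t = r * s -> drift n + noise (fun=> t) n = r ^+ 2.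
Proof.
move=> rE c0 tE; elim: n => [|n IH] /=; first by rewrite addr0.
rewrite addrACA -mulrDr IH tE.
by transitivity (r * (c * r + d + s)); [ring|rewrite -rE].
Qed.

End SquaredNormBound.

(* For s = 0 the quotient r / s is 0 in Rocq, which is right because z = 0 then. *)
Lemma contraction_step (R : realType) n (x b z : 'cV[R]_n) (M : 'M[R]_n) (d r s : R) :
  0 < r -> 0 <= d -> 0 <= s -> r = specnorm M * r + d + s ->
  enorm b <= d -> (s = 0 -> z = 0) ->
  enorm (M *m x + b + z) ^+ 2 <=
    specnorm M * enorm x ^+ 2 + r * d + r / s * enorm z ^+ 2.
Proof.
move=> r0 d0 s0 rE bd sz; set c := specnorm M in rE *.
have c0 : 0 <= c by exact: specnorm_ge0.
(* Each squared norm is split as weight times value, with weights [c r], [d], [s] of total [r];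
   Jensen is then applied twice. *)
have hM : enorm (M *m x) ^+ 2 <= (c * r) * (c * enorm x ^+ 2 / r).
  rewrite (_ : _ * _ = (c * enorm x) ^+ 2).
    rewrite ler_pXn2r ?nnegrE ?mulr_ge0 ?enorm_ge0//.
    exact: enorm_mulmx_le.
  by field; rewrite gt_eqF.
have hb : enorm b ^+ 2 <= d * d.
  by rewrite -expr2 ler_pXn2r ?nnegrE ?enorm_ge0.
have hz : enorm z ^+ 2 <= s * (enorm z ^+ 2 / s).
  have [s00|sn0] := eqVneq s 0; first by rewrite sz// enorm0 expr0n s00 mul0r.
  by rewrite mulrCA mulfV// mulr1.
have cr0 : 0 <= c * r by rewrite mulr_ge0// ltW.
have cx0 : 0 <= c * enorm x ^+ 2 / r.
  by rewrite mulr_ge0 ?invr_ge0 ?(ltW r0)// mulr_ge0 ?sqr_ge0.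
have hMb := enorm_sqrD_le cr0 d0 cx0 d0 hM hb.
have zs0 : 0 <= enorm z ^+ 2 / s by rewrite mulr_ge0 ?invr_ge0 ?sqr_ge0.
apply: (le_trans (enorm_sqrD_le (addr_ge0 cr0 d0) s0 (addr_ge0 cx0 d0) zs0 hMb hz)).
rewrite -rE le_eqVlt; apply/orP; left; apply/eqP.
by rewrite !mulrDr mulrA; congr (_ + _ + _); [field; rewrite gt_eqF|ring].
Qed.

(** * Worst-case CVaR of the event-triggered loop *)

Theorem corollaryV4 (R : realType) (nx nu nw : nat)
  (A : 'M[R]_nx) (B : 'M[R]_(nx, nu)) (E : 'M[R]_(nx, nw))
  (K : 'M[R]_(nu, nx)) (Sw : 'M[R]_nw) (eps r sigma4 : R)
  (hSw : posdef Sw)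
  (heps : 0 < eps < 1)
  (hABK : specnorm (A + B *m K) < 1)
  (hreach : reachable (A + B *m K) E)
  (hB : B != 0)
  (hr : 0 < r)
  (hr2 : r ^+ 2 >
    ((1 - specnorm (A + B *m K)) ^+ 2)^-1 * (eps^-1 * \tr (Sw *m E^T *m E)))
  (hsigma4 : sigma4 <= (specnorm B)^-1 *
    ((1 - specnorm (A + B *m K)) * r
     - Num.sqrt (eps^-1 * \tr (Sw *m E^T *m E))))
  (x0 xhat0 : 'cV[R]_nx)
  (hx0 : enorm x0 ^+ 2 - r ^+ 2 <= 0)
  (hxhat0 : xhat0 = x0 \/ enorm (K *m (xhat0 - x0)) <= sigma4)
  (x : (nat -> 'cV[R]_nw) -> nat -> 'cV[R]_nx)
  (hx : forall w, closed_loop A B E K sigma4 x0 xhat0 w (x w))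
  (k : nat) (hk : (0 < k)%N) :
  (worst_case_CVaR (ambiguity_set Sw k) eps
    (fun W => enorm (x (unstack W) k) ^+ 2 - r ^+ 2)%R <= 0)%E.
Proof.
have eps0 : 0 < eps by case/andP: heps.
have [tr0 trE0] := posdef_trace_eq0 E hSw.
set M := A + B *m K in hABK hr2 hsigma4 *; set c := specnorm M in hABK hr2 hsigma4 *.
set T := \tr (Sw *m E^T *m E) in hr2 hsigma4 tr0 trE0 *.
set s := Num.sqrt _ in hsigma4; pose d := (1 - c) * r - s.
have c0 : 0 <= c by exact: specnorm_ge0.
have s0 : 0 <= s by exact: sqrtr_ge0.
have s2 : s ^+ 2 = eps^-1 * T by rewrite sqr_sqrtr// mulr_ge0// invr_ge0 ltW.
(* The lower bound on [r ^+ 2] says that [s ^+ 2 < ((1 - c) r)^2]. *)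
have d0 : 0 <= d.
  have c1 : 0 < 1 - c by rewrite subr_gt0.
  rewrite subr_ge0 -(ler_pXn2r (n := 2)) ?nnegrE ?mulr_ge0 ?(ltW c1) ?(ltW hr)//.
  by rewrite s2 exprMn -ler_pdivrMl ?exprn_gt0// ltW.
have rE : r = c * r + d + s by rewrite /d; ring.
have sE0 : s = 0 -> E = 0.
  move=> s00; apply: trE0; apply/eqP; move/eqP: s2.
  by rewrite s00 expr0n eq_sym mulf_eq0 invr_eq0 gt_eqF.
(* The threshold condition reads [sigma4 <= d / |B|], and [d >= 0] takes care of the maximum with
   0. *)
have bound (e : 'cV[R]_nu) : enorm e <= Num.max sigma4 0 -> enorm (B *m e) <= d.
  move=> he; rewrite (le_trans (enorm_mulmx_le _ _))//.
  have B0 := specnorm_gt0 hB.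
  rewrite -ler_pdivlMl// (le_trans he)// ge_max hsigma4/=.
  by rewrite mulr_ge0// invr_ge0 ltW.
pose y (w : nat -> 'cV[R]_nw) i := enorm (E *m w i) ^+ 2.
have pathwise w n : enorm (x w n) ^+ 2 <= drift c d r n + noise c r s (y w) n.
  elim: n => [|n IH] /=.
    by case: (hx w) => ? [? [? [-> _ _ _ _]]]; rewrite addr0 -subr_le0.
  have [e /bound he ->] := closed_loop_step (hx w) hxhat0 n.
  apply: (le_trans (contraction_step _ hr d0 s0 rE he _)).
    by move=> /sE0 ->; rewrite mul0mx.
  by rewrite -/c addrACA -mulrDr addrA lerD2r lerD2r ler_wpM2l.
apply: ge_ereal_sup => _ [P hP <-].
have mean n : (n <= k)%N ->
    has_mean P (fun W => noise c r s (y (unstack W)) n) (noise c r s (fun=> T) n).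
  elim: n => [_|n IH nk] /=; first exact: has_mean0.
  apply: has_meanD; apply: has_meanZ; first exact/IH/ltnW.
  exact: has_mean_block.
apply: (le_trans (CVaR_le (b := drift c d r k - r ^+ 2) (ltW eps0) _ _ (mean k (leqnn _)))).
- by move=> W; apply: noise_ge0 => // [|i]; [exact: ltW|exact: sqr_ge0].
- by move=> W; rewrite addrAC lerD2r.
rewrite lee_fin.
(* [noise] is linear in its sequence, so [1 / eps] moves inside and turns [T] into [s ^+ 2]. *)
have scale n : eps^-1 * noise c r s (fun=> T) n = noise c r s (fun=> eps^-1 * T) n.
  by elim: n => [|n IH] /=; [rewrite mulr0|rewrite -IH; ring].
rewrite scale addrAC drift_noise_sum ?subrr// -s2.
have [->|sn0] := eqVneq s 0; first by rewrite expr0n !mulr0.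
by field.
Qed.
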